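(* Let $v\geq 2$ and let $q$ be a prime power. Let $H\cong PG(v,q)$ be a hyperplane of $PG(v+1,q)$, let $B\subset H$ be a $v$-fold strong blocking set in $H$ of size $k$, let $P_1,\ldots,P_{v+1}$ be $v+1$ independent points of $H$, and let $l_1,\ldots,l_{v+1}$ be concurrent lines of $PG(v+1,q)$ with $l_i\cap H=\{P_i\}$ for each $i$. Then $$B^{\star}=B\cup\bigcup_{i=1}^{v+1}\bigl(l_i\setminus\{P_i\}\bigr)$$ is a $(v+1)$-fold strong blocking set in $PG(v+1,q)$ of size $k+1+(v+1)(q-1)$.
   Context: For $2\leq t\leq v$, a point set $B$ in $PG(v,q)$ is a $t$-fold strong blocking set if every $(t-1)$-dimensional subspace of $PG(v,q)$ is spanned by $t$ points of $B$. *)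

(* Defs.v *)
From HB Require Import structures.
From mathcomp Require Import all_boot all_order all_algebra.

Set Implicit Arguments.
Unset Strict Implicit.
Unset Printing Implicit Defensive.

Import GRing.Theory VectorInternalTheory.
Local Open Scope ring_scope.

HB.instance Definition _ (F : finFieldType) (vT : vectType F) :=
  [Finite of {vspace vT} by <:].

(* PG(W) for a vector space W over F has the 1-dimensional subspaces of W as
   points; a projective subspace of dimension d is a vector subspace of
   dimension d + 1. *)
Definition pg_point (F : finFieldType) (vT : vectType F) :=
  {U : {vspace vT} | \dim U == 1%N}.

Section ProjectiveGeometry.
Variables (F : finFieldType) (vT : vectType F).

Definition pg_points (U : {vspace vT}) : {set pg_point vT} :=
  [set p : pg_point vT | (val p <= U)%VS].

Definition pg_span (S : {set pg_point vT}) : {vspace vT} :=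
  (\sum_(p in S) val p)%VS.

(* The notion is meant for 2 <= t < \dim W, i.e. t at least 2 and at most the
   projective dimension of PG(W). *)
Definition strong_blocking_set (t : nat) (W : {vspace vT})
    (B : {set pg_point vT}) : Prop :=
  B \subset pg_points W /\
  forall U : {vspace vT}, (U <= W)%VS -> \dim U = t ->
    exists S : {set pg_point vT},
      [/\ S \subset B, #|S| = t & pg_span S = U].

Definition independent_points (n : nat) (P : 'I_n -> pg_point vT) : Prop :=
  \dim (\sum_i val (P i))%VS = n.

Definition concurrent (n : nat) (l : 'I_n -> {vspace vT}) : Prop :=
  exists Q : pg_point vT, forall i, Q \in pg_points (l i).

End ProjectiveGeometry.

(* Main.v *)
(** The lines meet in a point Q off H, since otherwise all the P_i would be
    equal to Q.  A hyperplane U other than H meets H in a hyperplane of H,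
    spanned by v points of B.  As the P_i span H, some P_i is not in U; then
    l_i meets U in a point other than P_i, hence off H, which completes those v
    points to a spanning set of U.  If U = H, then v points of B spanning a
    hyperplane of H are completed by a point of B outside it, which exists as
    B lies in no hyperplane of H.  For the size, the points of the l_i off H
    and other than Q are the <x + a y_i> with a <> 0, where Q = <x> and
    P_i = <y_i>, and these are pairwise distinct. *)

Require Import Defs.
From mathcomp Require Import all_boot all_order all_algebra.

Import GRing.Theory.
Local Open Scope ring_scope.

Section ProjectivePoints.
Variables (F : finFieldType) (vT : vectType F).
Implicit Types (p : pg_point vT) (S B : {set pg_point vT}).
Implicit Types (U V W : {vspace vT}) (x y : vT).

Lemma pg_pick_neq0 p : vpick (val p) != 0.
Proof. by rewrite vpick0 -dimv_eq0 (eqP (valP p)). Qed.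

Lemma pg_point_line p : val p = <[vpick (val p)]>%VS.
Proof.
apply/esym/eqP; rewrite eqEdim -memvE memv_pick.
by rewrite (eqP (valP p)) dim_vline pg_pick_neq0.
Qed.

Lemma line_pg_point x : x != 0 -> exists p : pg_point vT, val p = <[x]>%VS.
Proof.
move=> xN0; have dx : \dim <[x]>%VS == 1%N by rewrite dim_vline xN0.
by exists (Sub <[x]>%VS dx); rewrite SubK.
Qed.

Lemma sub_pg_point p p' : (val p <= val p')%VS -> p = p'.
Proof.
move=> pp'; apply: val_inj; apply/eqP; rewrite eqEdim pp' /=.
by rewrite (eqP (valP p)) (eqP (valP p')).
Qed.

Lemma pg_span_sub S U : S \subset pg_points U -> (pg_span S <= U)%VS.
Proof.
move=> /subsetP SU; apply/subv_sumP => p /SU.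
by rewrite inE.
Qed.

(** No subspace lies strictly between [U] and [V], so any point of [V] off [U] completes the span;
    being off [U], it is not yet in [S]. *)
Lemma pg_span_extend p S U V :
    pg_span S = U -> ~~ (val p <= U)%VS -> (val p <= V)%VS -> (U <= V)%VS ->
    \dim V = (\dim U).+1 ->
  #|p |: S| = #|S|.+1 /\ pg_span (p |: S) = V.
Proof.
move=> SU pU pV UV dV.
have pS : p \notin S.
  by apply: contra pU => pS; rewrite -SU; exact: (sumv_sup p).
split; first by rewrite cardsU1 pS.
rewrite /pg_span big_setU1 //= -/(pg_span S) SU; apply/eqP.
rewrite eqEdim subv_add pV UV dV ltnNge; apply: contra pU => dle.
have /eqP -> : U == (val p + U)%VS by rewrite eqEdim addvSr.
exact: addvSl.
Qed.

Lemma exists_hyperplane_avoiding x W : x != 0 -> x \in W ->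
  exists U, [/\ (U <= W)%VS, (\dim U).+1 = \dim W & x \notin U].
Proof.
move=> xN0 xW; exists (W :\: <[x]>)%VS; split; first exact: diffvSl.
  rewrite -(dimv_cap_compl W <[x]>%VS) (capv_idPr _) ?dim_vline ?xN0 //.
apply/negP => xU; have : x \in ((W :\: <[x]>) :&: <[x]>)%VS.
  by rewrite memv_cap xU memv_line.
by rewrite capv_diff memv0 (negPf xN0).
Qed.

Lemma strong_blocking_set_span t W B :
    (0 < t)%N -> \dim W = t.+1 -> strong_blocking_set t W B ->
  exists S, [/\ S \subset B, #|S| = t.+1 & pg_span S = W].
Proof.
move=> t0 dW [BW hB].
have pickN0 U : (0 < \dim U)%N -> vpick U != 0.
  by rewrite vpick0 -dimv_eq0 lt0n.
have [|U1 [U1W dU1 _]] :=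
    exists_hyperplane_avoiding (vpick W) W _ (memv_pick W).
  by rewrite pickN0 ?dW.
have {}dU1 : \dim U1 = t by apply/eqP; rewrite -eqSS dU1 dW.
have [S [SB cS sS]] := hB _ U1W dU1.
have xN0 : vpick U1 != 0 by rewrite pickN0 ?dU1.
(* [U2] is a witness that [B] leaves [U1]: it misses a nonzero vector of [U1] (there is one since
   [t > 0]), yet if [B] were inside [U1], then [U2], spanned by points of [B], would be contained in
   [U1] and equal to it by dimension. *)
have [||U2 [U2W dU2 xU2]] := @exists_hyperplane_avoiding (vpick U1) W.
- by [].
- exact: (subvP U1W) (memv_pick U1).
have {}dU2 : \dim U2 = t by apply/eqP; rewrite -eqSS dU2 dW.
have [S2 [S2B cS2 sS2]] := hB _ U2W dU2.
have /subsetPn[p pB] : ~~ (B \subset pg_points U1).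
  apply: contra xU2 => BU1.
  have U21 : (U2 <= U1)%VS.
    by rewrite -sS2 pg_span_sub // (subset_trans S2B).
  have /eqP -> : U2 == U1 by rewrite eqEdim U21 dU1 dU2 leqnn.
  exact: memv_pick.
rewrite inE => pU1.
have pW : (val p <= W)%VS by move/subsetP: BW => /(_ p pB); rewrite inE.
have [|cpS spS] := pg_span_extend p S U1 W sS pU1 pW U1W; first by rewrite dU1.
exists (p |: S); split; rewrite ?cpS ?cS //.
by rewrite subUset sub1set pB.
Qed.

(** A sum of [n] lines through 0 that has dimension [n] is direct, so no summand can occur twice. *)
Lemma independent_points_inj n (P : 'I_n -> pg_point vT) :
  independent_points P -> injective P.
Proof.
move=> hP i j Pij; apply/eqP/negPn/negP => ij.
have : directv (\sum_i val (P i))%VS.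
  rewrite directvE /= hP; apply/eqP.
  rewrite (eq_bigr (fun=> 1%N)) => [|m _]; last exact: (eqP (valP (P m))).
  by rewrite sum1_card card_ord.
move/directv_sumP => /(_ i isT) cap0.
have : (val (P i) <= 0)%VS.
  rewrite -cap0 subv_cap subvv (sumv_sup j) //=; last by rewrite Pij.
  by rewrite eq_sym.
by rewrite subv0 -dimv_eq0 (eqP (valP (P i))).
Qed.

(** The 1 counts [Q], which lies in the union because the index [i0] exists; each line contributes
    one further point for each nonzero scalar. *)
Lemma card_concurrent_lines (I : finType) (i0 : I) (P : I -> pg_point vT)
    (Q : pg_point vT) (l : I -> {vspace vT}) (H : {vspace vT}) :
    injective P -> (forall i, P i \in pg_points H) -> Q \notin pg_points H ->
    (forall i, l i = (val Q + val (P i))%VS) ->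
  #|\bigcup_i (pg_points (l i) :\ P i)| = (1 + #|I| * (#|F| - 1))%N.
Proof.
move=> injP PH QH lE.
pose x := vpick (val Q); pose y i := vpick (val (P i)).
have QE : val Q = <[x]>%VS by exact: pg_point_line.
have PE i : val (P i) = <[y i]>%VS by exact: pg_point_line.
have yN0 i : y i != 0 by exact: pg_pick_neq0.
have xH : x \notin H by move: QH; rewrite inE QE -memvE.
have yH i : y i \in H by move: (PH i); rewrite inE PE -memvE.
have xyH i a : x + a *: y i \notin H by rewrite rpredDr ?rpredZ ?yH.
have xyN0 i a : x + a *: y i != 0.
  by apply: contraNneq (xyH i a) => ->; exact: mem0v.
(* The default [Q] is never reached, since [x + a *: y i] is off [H] and hence nonzero. *)
pose f (u : I * F) : pg_point vT := insubd Q <[x + u.2 *: y u.1]>%VS.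
have fE i a : val (f (i, a)) = <[x + a *: y i]>%VS.
  by rewrite insubdK // unfold_in dim_vline xyN0.
(* Two generators of one point differ by a factor [c]; comparing them modulo [H], where only [x]
   survives, forces [c = 1]. *)
have f_eq i j a b : f (i, a) = f (j, b) -> a *: y i = b *: y j.
  move/(congr1 val); rewrite !fE => eqf.
  have /vlineP[c] : x + a *: y i \in <[x + b *: y j]>%VS.
    by rewrite -eqf memv_line.
  have [->|c1] := eqVneq c 1; first by rewrite scale1r => /addrI.
  rewrite scalerDr => eqc.
  have : (1 - c) *: x \in H.
    have -> : (1 - c) *: x = c *: (b *: y j) - a *: y i.
      rewrite scalerBl scale1r -{1}[x](addrK (a *: y i)) eqc.
      by rewrite addrC !addrA addNr add0r.
    by rewrite rpredB ?rpredZ.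
  by rewrite rpredZeq subr_eq0 eq_sym (negPf c1) (negPf xH).
have f0 i : f (i, 0) = Q.
  by apply: val_inj; rewrite fE scale0r addr0 QE.
have -> : \bigcup_i (pg_points (l i) :\ P i)
          = Q |: f @: setX [set: I] [set~ 0].
  apply/setP => p; rewrite !inE; apply/bigcupP/idP => [[i _]|].
    rewrite !inE lE => /andP[pP pl].
    have /memv_addP[u + [w + zE]] : vpick (val p) \in (val Q + val (P i))%VS.
      exact: (subvP pl) (memv_pick _).
    rewrite QE PE => /vlineP[c cE] /vlineP[d dE]; rewrite {}cE {}dE {u w} in zE.
    (* If [c = 0], the point would be [P i], which was removed; dividing by [c] then normalizes the
       coefficient of [x] to 1. *)
    have cN0 : c != 0.
      apply: contra pP => /eqP c0; apply/eqP/sub_pg_point.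
      by rewrite pg_point_line -memvE zE c0 scale0r add0r PE memvZ ?memv_line.
    have -> : p = f (i, c^-1 * d).
      apply: sub_pg_point; rewrite pg_point_line -memvE zE fE.
      apply/vlineP; exists c.
      by rewrite scalerDr !scalerA mulrA divff ?mul1r.
    have [->|dN0] := eqVneq (c^-1 * d) 0; first by rewrite f0 eqxx.
    by rewrite imset_f ?orbT // !inE.
  have offP i a : f (i, a) \in pg_points (l i) :\ P i.
    rewrite !inE lE; apply/andP; split.
      apply: contraNneq (xyH i a) => fP.
      by move: (PH i); rewrite -fP inE fE memvE.
    by rewrite fE -memvE memv_add // ?QE ?PE ?memvZ ?memv_line.
  case/orP => [/eqP ->|/imsetP[[i a] _ ->]]; last by exists i.
  by exists i0 => //; rewrite -(f0 i0).
rewrite cardsU1 card_in_imset => [|[i a] [j b]].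
  rewrite cardsX cardsT cardsC1 subn1 (_ : Q \notin _) //.
  (* Writing [Q] as [f (i, 0)] lets [f_eq] rule out a nonzero parameter. *)
  apply/imsetP => -[[i a]]; rewrite !inE /= => aN0.
  rewrite -(f0 i) => /f_eq /eqP; rewrite scale0r eq_sym scaler_eq0.
  by rewrite (negPf aN0) (negPf (yN0 i)).
rewrite !inE /= => aN0 bN0 /f_eq eqab.
have ij : i = j.
  apply/injP/sub_pg_point; rewrite PE -memvE.
  have -> : y i = (a^-1 * b) *: y j.
    by rewrite -scalerA -eqab scalerA mulVf ?scale1r.
  by rewrite PE memvZ ?memv_line.
move: eqab; rewrite ij => /eqP; rewrite -subr_eq0 -scalerBl scaler_eq0.
by rewrite (negPf (yN0 j)) orbF subr_eq0 => /eqP ->.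
Qed.

End ProjectivePoints.

Theorem theorem6 (v q k : nat) (hv : (2 <= v)%N)
  (F : finFieldType) (hF : #|F| = q)
  (H : {vspace 'rV[F]_(v.+2)}) (hH : \dim H = v.+1)
  (B : {set pg_point 'rV[F]_(v.+2)})
  (hB : strong_blocking_set v H B) (hk : #|B| = k)
  (P : 'I_(v.+1) -> pg_point 'rV[F]_(v.+2))
  (hPH : forall i, P i \in pg_points H) (hP : independent_points P)
  (l : 'I_(v.+1) -> {vspace 'rV[F]_(v.+2)})
  (hl : forall i, \dim (l i) = 2%N) (hconc : concurrent l)
  (hlH : forall i, pg_points (l i) :&: pg_points H = [set P i]) :
  let Bstar := B :|: \bigcup_i (pg_points (l i) :\ P i) in
  strong_blocking_set v.+1 fullv Bstar /\
  #|Bstar| = (k + 1 + (v + 1) * (q - 1))%N.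
Proof.
have injP := independent_points_inj _ _ _ P hP.
have Pl i : (val (P i) <= l i)%VS.
  have : P i \in pg_points (l i) :&: pg_points H by rewrite hlH set11.
  by rewrite !inE => /andP[].
have PH i : (val (P i) <= H)%VS by move: (hPH i); rewrite inE.
have [Q Ql] := hconc.
have QH : Q \notin pg_points H.
  apply/negP => QH; have QP i : Q = P i.
    by apply/set1P; rewrite -hlH inE Ql QH.
  have /injP/(congr1 val) /= v0 : P ord0 = P ord_max by rewrite -!QP.
  by move: hv; rewrite -v0.
have QNH : ~~ (val Q <= H)%VS by move: QH; rewrite inE.
(* [Q] is off [H] and [P i] is in [H], so they are distinct points of the line and span it. *)
have lE i : l i = (val Q + val (P i))%VS.
  apply/eqP; rewrite eq_sym eqEdim subv_add Pl hl.
  have := Ql i; rewrite inE => -> /=.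
  rewrite ltnNge; apply: contra QNH => dle.
  apply: subv_trans (PH i).
  have /eqP -> : val (P i) == (val Q + val (P i))%VS.
    by rewrite eqEdim addvSr (eqP (valP (P i))).
  exact: addvSl.
have [BH hBH] := hB.
move=> Bstar; split; last first.
  rewrite /Bstar cardsU hk (card_concurrent_lines _ _ _ ord0 P Q l H) //.
  rewrite card_ord hF (addn1 v) addnA (_ : _ :&: _ = set0) ?cards0 ?subn0 //.
  (* A point of [B] is in [H], where [l i] has only the removed point [P i]. *)
  apply/setP => p; rewrite !inE; apply/negP => /andP[pB /bigcupP[i _]].
  rewrite !inE => /andP[/negP pP pl]; apply: pP; rewrite -in_set1 -hlH.
  by rewrite inE (subsetP BH) // inE pl.
have BBs : B \subset Bstar by exact: subsetUl.
split; first by apply/subsetP => p _; rewrite inE subvf.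
move=> U _ dU; have [UH|UH] := eqVneq U H.
  have [|S [SB cS sS]] := strong_blocking_set_span _ _ v H B _ hH hB.
    exact: leq_trans hv.
  by exists S; split; rewrite ?UH // (subset_trans SB).
have PsumH : (\sum_i val (P i))%VS = H.
  by apply/eqP; rewrite eqEdim hP hH leqnn andbT; apply/subv_sumP.
have /existsP[i PU] : [exists i, ~~ (val (P i) <= U)%VS].
  rewrite -negb_forall; apply: contra UH => /forallP PU.
  by rewrite eq_sym eqEdim dU hH leqnn andbT -PsumH; apply/subv_sumP.
have dim_le (V : {vspace 'rV[F]_v.+2}) : (\dim V <= v.+2)%N.
  by apply: leq_trans (dimvS (subvf V)) _; rewrite dimvf /dim /= mul1n.
have dim_hyp V : \dim V = v.+1 -> V != U -> \dim (U + V) = v.+2.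
  move=> dV VU; apply/eqP; rewrite eqn_leq dim_le /=.
  rewrite ltnNge; apply: contra VU => dle.
  have /eqP {1}-> : V == (U + V)%VS by rewrite eqEdim addvSr dV.
  by rewrite eq_sym eqEdim addvSl dU.
have dUH : \dim (U :&: H) = v.
  have := dimv_sum_cap U H.
  rewrite dim_hyp // 1?eq_sym // dU hH addSnnS => /eqP.
  by rewrite eqn_add2l => /eqP[].
have [S [SB cS sS]] := hBH (U :&: H)%VS (capvSr _ _) dUH.
(* The dimensions [v.+1] of [U] and 2 of [l i] add up to more than the [v.+2] of the whole space. *)
have capN0 : vpick (U :&: l i)%VS != 0.
  rewrite vpick0 -dimv_eq0 -lt0n -(ltn_add2l (\dim (U + l i))) addn0.
  by rewrite dimv_sum_cap dU hl addn2 ltnS dim_le.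
have [R RE] := line_pg_point _ _ _ capN0.
have /andP[RU Rl] : (val R <= U)%VS && (val R <= l i)%VS.
  by rewrite -subv_cap RE -memvE memv_pick.
have RP : R != P i by apply: contra PU => /eqP <-.
have RH : ~~ (val R <= H)%VS.
  by apply: contra RP => RH; rewrite -in_set1 -hlH !inE Rl.
(* [U :&: H] has codimension 1 in [U], and [R] is in [U] but off [H]. *)
have [||cS' sS'] := pg_span_extend _ _ R S _ U sS _ RU (capvSl _ _).
- by rewrite subv_cap (negPf RH) andbF.
- by rewrite dUH.
exists (R |: S); split; rewrite ?cS' ?cS //.
rewrite subUset sub1set (subset_trans SB) // andbT inE.
by apply/orP; right; apply/bigcupP; exists i; rewrite // !inE RP.
Qed.
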